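(* Let $(n,m)$, with $m\le n$, be the complexity parameters of an MLD instance $I_{\mathrm{MLD}}=(\bar H,\bar s,\bar t)$ and let $I_{\mathrm{MQ}}=\alpha_{n,m}(I_{\mathrm{MLD}})$ be the MQ instance defined in the context. Then the complexity parameters $(\mathsf n,\mathsf m)$ of $I_{\mathrm{MQ}}$ (number of variables and number of equations) are in $\mathcal{O}(n\log_2^2 n)$.
   Context: $\mathbb{F}=\mathbb{F}_2$. An MLD instance with complexity parameters $(n,m)$ is a triple $(\bar H,\bar s,\bar t)$ with $\bar H\in\mathbb{F}^{m\times n}$, $\bar s\in\mathbb{F}^m$ and $\bar t\le n$ a positive integer (the problem asks for $v\in\mathbb{F}^n$ of Hamming weight at most $\bar t$ with $\bar Hv^\top=\bar s^\top$). An MQ instance is a system of polynomial equations of degree at most 2 over $\mathbb{F}$; its complexity parameters $(\mathsf n,\mathsf m)$ are its number of variables and its number of equations. Let $\ell=\lfloor\log_2 n\rfloor+1$; $\bar t$ is also written in binary as $(\bar t_1,\dots,\bar t_\ell)\in\mathbb{F}^\ell$, with $\bar t=\sum_j\bar t_j2^{j-1}$. Quadratization: given a polynomial equation $f=0$ over $\mathbb{F}$, for each monomial $x_{i_1}x_{i_2}\cdots x_{i_d}$ of $f$ of degree $d\ge3$ introduce $d-2$ new variables $y_1,\dots,y_{d-2}$ with the equations $y_1=x_{i_1}x_{i_2}$, $y_2=y_1x_{i_3}$, ..., $y_{d-2}=y_{d-3}x_{i_{d-1}}$, and rewrite the monomial in $f$ as $y_{d-2}x_{i_d}$. The resulting system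 of equations of degree at most 2 (including the rewritten $f=0$) is $\mathtt{quadr}(f)$; for a system $S$, $\mathtt{quadr}(S)=\bigcup_{f\in S}\mathtt{quadr}(f)$. The map is $\alpha_{n,m}=\mathtt{pcce}_{n,m}\cup\mathtt{hwce}_{n,m}\cup\mathtt{wce}_{n,m}$, a system depending only on $n$ and $m$, in which the entries $h_{i,j}$ of $H$, $s_i$ of $s$ and the bits $t_1,\dots,t_\ell$ of $t$ are variables; $\alpha_{n,m}(I_{\mathrm{MLD}})$ is the system obtained by evaluating these variables at $\bar H,\bar s,(\bar t_1,\dots,\bar t_\ell)$. Here: - $\mathtt{pcce}_{n,m}=\{\sum_{j=1}^n h_{i,j}v_j+s_i=0\}_{i=1,\dots,m}$; - $\mathtt{hwce}_{n,m}=\mathtt{quadr}\Big(\Big\{a^{(i)}_j=a^{(i-1)}_j+\Big(\prod_{h=1}^{j-1}a^{(i-1)}_h\Big)v_i\Big\}_{i=1,\dots,n,\ j=1,\dots,\ell}\Big)$, with variables $v_i$ and $a^{(i)}_j$, and with $a^{(0)}_j=0$ for all $j$; - $\mathtt{wce}_{n,m}=\mathtt{quadr}(\{F_\ell\})$, i.e. $\mathtt{quadr}$ applied to the equation $F_\ell=0$, where $F_\ell=\sum_{j=1}^{\ell}\Big[(a^{(n)}_j+t_j)\prod_{h=j+1}^{\ell}(a^{(n)}_h+t_h+1)\Big](t_j+1)\in\mathbb{F}[a^{(n)}_1,\dots,a^{(n)}_\ell,t_1,\dots,t_\ell]$.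
   Formalization: Quadratization counts only monomials in the unknowns v, a; the bits t_j (and h, s) are treated as coefficients. If t_j count as variables of F_ℓ, as written, F_ℓ has about 3^ℓ monomials, giving at least order n^{log_2 3} new variables and equations, so the stated bound fails. *)

(* Defs.v *)
From HB Require Import structures.
From mathcomp Require Import all_boot all_order all_algebra.
From mathcomp Require Import finmap.
From mathcomp Require Import monalg.
From mathcomp Require Import reals exp.

Set Implicit Arguments.
Unset Strict Implicit.
Unset Printing Implicit Defensive.

Import Order.TTheory GRing.Theory Num.Theory.

Local Open Scope ring_scope.

(* Polynomials over [K] in the variables [V] are {malg K[{cmonom V}]}.  An
   equation f = 0 is represented by f; a system is a sequence of polynomials,
   so that equations are counted with multiplicity. *)

Definition var (K : comNzRingType) (V : choiceType) (x : V) :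
  {malg K[{cmonom V}]} := << ucm x >>.

Section Quadratization.
Variables (K : comNzRingType) (V : choiceType).
Local Notation poly := {malg K[{cmonom V}]}.

(* x_{i_1}, ..., x_{i_d}, each variable repeated according to its exponent. *)
Definition mvars (mu : {cmonom V}) : seq V :=
  flatten [seq nseq (mu x) x | x <- finsupp mu].

(* [New f mu k] is the variable y_k introduced for the monomial [mu] of [f]. *)
Inductive qvar := Old of V | New of poly & {cmonom V} & nat.

Definition qvar_code (x : qvar) : V + poly * {cmonom V} * nat :=
  match x with Old v => inl v | New f mu k => inr (f, mu, k) end.

Definition qvar_decode (c : V + poly * {cmonom V} * nat) : qvar :=
  match c with inl v => Old v | inr (f, mu, k) => New f mu k end.

Lemma qvar_codeK : cancel qvar_code qvar_decode.
Proof. by case. Qed.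

HB.instance Definition _ := Choice.copy qvar (can_type qvar_codeK).

Local Notation qpoly := {malg K[{cmonom qvar}]}.

Section Monomial.
Variables (f : poly) (mu : {cmonom V}).

(* For 0 <= k < d, the variable x_{i_{k+1}}. *)
Definition qfactor (k : nat) : qpoly :=
  nth 1 [seq var K (Old x) | x <- mvars mu] k.

(* y_k, with the convention y_0 = x_{i_1}. *)
Definition qchain (k : nat) : qpoly :=
  if k is 0 then qfactor 0 else var K (New f mu k).

(* y_k = y_{k-1} x_{i_{k+1}} for 1 <= k <= d - 2; empty if d <= 2. *)
Definition qdefs : seq qpoly :=
  [seq qchain k - qchain k.-1 * qfactor k | k <- iota 1 (mdeg mu - 2)].

Definition qmonom : qpoly :=
  if (3 <= mdeg mu)%N then qchain (mdeg mu - 2) * qfactor (mdeg mu).-1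
  else \prod_(x <- mvars mu) var K (Old x).

End Monomial.

Definition quadr1 (f : poly) : seq qpoly :=
  rcons (flatten [seq qdefs f mu | mu <- msupp f])
        (\sum_(mu <- msupp f) f@_mu *: qmonom f mu).

Definition quadr (S : seq poly) : seq qpoly := flatten [seq quadr1 f | f <- S].

End Quadratization.

(* Variables that actually occur: in the evaluated system below these are all the
   unknowns, since every v_i and a^{(i)}_j occurs in hwce and every y_k occurs
   in its defining equation, with coefficient 1 or -1. *)
Definition sys_vars (K : comNzRingType) (V : choiceType)
    (S : seq {malg K[{cmonom V}]}) : seq V :=
  undup (flatten [seq flatten [seq mvars mu | mu <- msupp f] | f <- S]).

Definition num_vars (K : comNzRingType) (V : choiceType)
  (S : seq {malg K[{cmonom V}]}) : nat := size (sys_vars S).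

Definition num_eqs (K : comNzRingType) (V : choiceType)
  (S : seq {malg K[{cmonom V}]}) : nat := size S.

Record MLD (n m : nat) := MkMLD {
  mldH : 'M['F_2]_(m, n);
  mlds : 'rV['F_2]_m;
  mldt : nat;
  mldt_bounds : (0 < mldt <= n)%N
}.

Definition bitlen (n : nat) : nat := (trunc_log 2 n).+1.

Definition bit (t j : nat) : 'F_2 := (odd (t %/ 2 ^ j))%:R.

Section Alpha.
Variables n m : nat.
Local Notation l := (bitlen n).

(* All indices are shifted by one: they start at 0. *)

(* The inputs of the map alpha. *)
Inductive input := Hin of 'I_m & 'I_n | Sin of 'I_m | Tin of 'I_l.

Definition input_code (p : input) : 'I_m * 'I_n + 'I_m + 'I_l :=
  match p with
  | Hin i j => inl (inl (i, j)) | Sin i => inl (inr i) | Tin j => inr j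
  end.

Definition input_decode (c : 'I_m * 'I_n + 'I_m + 'I_l) : input :=
  match c with
  | inl (inl (i, j)) => Hin i j | inl (inr i) => Sin i | inr j => Tin j
  end.

Lemma input_codeK : cancel input_code input_decode.
Proof. by case. Qed.

HB.instance Definition _ := Choice.copy input (can_type input_codeK).

(* The unknowns of the system: [Avar i j] is a^{(i+1)}_{j+1}. *)
Inductive unknown := Vvar of 'I_n | Avar of 'I_n & 'I_l.

Definition unknown_code (u : unknown) : 'I_n + 'I_n * 'I_l :=
  match u with Vvar i => inl i | Avar i j => inr (i, j) end.

Definition unknown_decode (c : 'I_n + 'I_n * 'I_l) : unknown :=
  match c with inl i => Vvar i | inr (i, j) => Avar i j end.

Lemma unknown_codeK : cancel unknown_code unknown_decode.
Proof. by case. Qed.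

HB.instance Definition _ := Choice.copy unknown (can_type unknown_codeK).

(* The system alpha_{n,m} has coefficients in F_2[h, s, t]: the polynomial ring
   F_2[h, s, t, v, a] is viewed as F_2[h, s, t][v, a], so the
   quadratization acts on the monomials in the unknowns v, a.  If the t_j were
   counted among the variables of a monomial, F_l would have about 3^l monomials,
   that is, of the order of n^(log_2 3), beyond O(n log_2^2 n). *)
Definition coef : comNzRingType := {malg 'F_2[{cmonom input}]}.
Local Notation ipoly := {malg coef[{cmonom unknown}]}.
Local Notation opoly := {malg coef[{cmonom (qvar coef unknown)}]}.

Definition inp (p : input) : coef := var 'F_2 p.

Definition pcce : seq opoly :=
  [seq \sum_(j < n) inp (Hin i j) *: var coef (Old coef (Vvar j))
         + (inp (Sin i))%:MP | i <- enum 'I_m].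

(* a^{(i)}_{j+1} for 0 <= i <= n, with a^{(0)} = 0. *)
Definition acc (i : 'I_n.+1) (j : 'I_l) : ipoly :=
  if unlift ord0 i is Some i' then var coef (Avar i' j) else 0.

Definition hwce_eq (i : 'I_n) (j : 'I_l) : ipoly :=
  let prev := acc (widen_ord (leqnSn n) i) in
  acc (lift ord0 i) j
    - (prev j + (\prod_(h < l | (h < j)%N) prev h) * var coef (Vvar i)).

Definition hwce : seq opoly :=
  quadr [seq hwce_eq i j | i <- enum 'I_n, j <- enum 'I_l].

Definition F_l : ipoly :=
  let a := acc ord_max in
  let t (j : 'I_l) : ipoly := (inp (Tin j))%:MP in
  \sum_(j < l)
    ((a j + t j) * \prod_(h < l | (j < h)%N) (a h + t h + 1)) * (t j + 1).

Definition wce : seq opoly := quadr [:: F_l].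

Definition alpha : seq opoly := pcce ++ hwce ++ wce.

Section Evaluation.
Variable I : MLD n m.

Definition input_val (p : input) : 'F_2 :=
  match p with
  | Hin i j => mldH I i j
  | Sin i => mlds I 0 i
  | Tin j => bit (mldt I) j
  end.

Definition eval_coef (c : coef) : 'F_2 :=
  \sum_(mu <- msupp c) c@_mu * \prod_(p <- finsupp mu) input_val p ^+ mu p.

Definition eval_poly (f : opoly) : {malg 'F_2[{cmonom (qvar coef unknown)}]} :=
  \sum_(mu <- msupp f) << eval_coef f@_mu *g mu >>.

Definition alpha_eval : seq {malg 'F_2[{cmonom (qvar coef unknown)}]} :=
  [seq eval_poly f | f <- alpha].

End Evaluation.
End Alpha.

Definition log2 (R : realType) (x : R) : R := ln x / ln 2.

(* Main.v *)
(* Put l = bitlen n = O(log n).  Quadratizing f costs one equation, plus one new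
   variable and one equation for each monomial and each unit of degree above 2.
   Each of the n * l equations of hwce has at most 3 monomials, of degree at most
   l + 1, whence O(n l^2).  The polynomial F_l has an exponential expansion in l,
   but it is multilinear in the l unknowns a^(n), hence has at most
   2 ^ l <= 2 n monomials, of degree at most l, whence O(n l). *)
Require Import Defs.
From mathcomp Require Import all_boot all_order all_algebra.
From mathcomp Require Import finmap.
From mathcomp Require Import monalg.
From mathcomp Require Import reals exp.
From mathcomp Require Import zify.

Set Implicit Arguments.
Unset Strict Implicit.
Unset Printing Implicit Defensive.

Import Order.TTheory GRing.Theory Num.Theory.

Local Open Scope ring_scope.

(** * Degree, exponent and support-size bounds for polynomials *)

Section Bounds.
Variables (K : comNzRingType) (V : choiceType).
Local Notation poly := {malg K[{cmonom V}]}.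
Implicit Types (p q : poly) (phi : {cmonom V} -> nat).

(** The weight [phi] is later either the total degree or the exponent of one fixed variable, so one
    set of closure rules serves for degree bounds, multilinearity and absence of a variable. *)
Definition mbound phi (d : nat) p := forall mu, mu \in msupp p -> (phi mu <= d)%N.

Lemma mbound0 phi d : mbound phi d 0.
Proof. by move=> mu; rewrite msupp0. Qed.

Lemma mbound_leq phi d e p : (d <= e)%N -> mbound phi d p -> mbound phi e p.
Proof. by move=> le_de bp mu /bp /leq_trans->. Qed.

Lemma mboundD phi d p q : mbound phi d p -> mbound phi d q -> mbound phi d (p + q).
Proof.
move=> bp bq mu /(fsubsetP (msuppD_le _ _)); rewrite in_fsetU.
by case/orP => [/bp|/bq].
Qed.

Lemma mboundB phi d p q : mbound phi d p -> mbound phi d q -> mbound phi d (p - q).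
Proof. by move=> bp bq; apply: mboundD => // mu; rewrite msuppN => /bq. Qed.

Lemma mboundZ phi d c p : mbound phi d p -> mbound phi d (c *: p).
Proof. by move=> bp mu /(fsubsetP (msuppZ_le _ _)) /bp. Qed.

Lemma mbound_sum phi d (I : Type) (r : seq I) (P : pred I) (F : I -> poly) :
  (forall i, P i -> mbound phi d (F i)) -> mbound phi d (\sum_(i <- r | P i) F i).
Proof.
by move=> bF; apply: big_ind => //; [exact: mbound0 | move=> *; exact: mboundD].
Qed.

Lemma mboundU phi d mu : (phi mu <= d)%N -> mbound phi d (<< mu >> : poly).
Proof. by move=> le_d nu; rewrite msuppU1 in_fset1 => /eqP->. Qed.

Lemma mbound_var_deg (x : V) : mbound mdeg 1 (var K x).
Proof. by apply: mboundU; rewrite mdegU. Qed.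

Lemma mbound_var_exp (x y : V) :
  mbound (fun mu : {cmonom V} => mu y) (y == x) (var K x).
Proof. by apply: mboundU; rewrite cmU eq_sym. Qed.

Section Additive.
Variable phi : {cmonom V} -> nat.
Hypotheses (phi1 : phi mone = 0%N)
  (phiM : forall mu nu, phi (mmul mu nu) = (phi mu + phi nu)%N).

Lemma mboundC d c : mbound phi d (c%:MP : poly).
Proof.
by move=> mu /(fsubsetP (msuppC_le _)); rewrite in_fset1 => /eqP->; rewrite phi1.
Qed.

Lemma mbound1 d : mbound phi d (1 : poly).
Proof. by rewrite -mpolyC1E; exact: mboundC. Qed.

Lemma mboundM d e p q :
  mbound phi d p -> mbound phi e q -> mbound phi (d + e) (p * q).
Proof.
move=> bp bq mu /msuppM_le[m1 [m2 [/bp le1 /bq le2 ->]]].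
by rewrite phiM leq_add.
Qed.

Lemma mbound_prod (I : Type) (r : seq I) (P : pred I) (F : I -> poly) (d : I -> nat) :
  (forall i, P i -> mbound phi (d i) (F i)) ->
  mbound phi (\sum_(i <- r | P i) d i) (\prod_(i <- r | P i) F i).
Proof.
move=> bF; apply: big_rec2 => [|i e p Pi bp]; first exact: mbound1.
by apply: mboundM; auto.
Qed.

End Additive.

Lemma card_msuppM p q : (#|` msupp (p * q)| <= #|` msupp p| * #|` msupp q|)%N.
Proof.
rewrite -(size_allpairs (fun k1 k2 => mmul k1 k2)).
apply: uniq_leq_size (fset_uniq _) _ => mu /msuppM_le[m1 [m2 [m1p m2q ->]]].
exact: allpairs_f.
Qed.

Lemma card_msuppD p q : (#|` msupp (p + q)| <= #|` msupp p| + #|` msupp q|)%N.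
Proof.
apply: leq_trans (fsubset_leq_card (msuppD_le p q)) _.
by rewrite -cardfsUI leq_addr.
Qed.

Lemma card_msuppB p q : (#|` msupp (p - q)| <= #|` msupp p| + #|` msupp q|)%N.
Proof. by rewrite -(msuppN q); exact: card_msuppD. Qed.

Lemma card_msupp_prod1 (I : Type) (r : seq I) (P : pred I) (F : I -> poly) :
  (forall i, P i -> #|` msupp (F i)| <= 1)%N ->
  (#|` msupp (\prod_(i <- r | P i) F i)| <= 1)%N.
Proof.
move=> F1; apply: (big_ind (fun p : poly => #|` msupp p| <= 1)%N) => //.
  by rewrite msuppU1 cardfs1.
by move=> p q p1 q1; apply: leq_trans (card_msuppM p q) (leq_mul p1 q1).
Qed.

Lemma card_msupp_var (x : V) : #|` msupp (var K x)| = 1%N.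
Proof. by rewrite msuppU1 cardfs1. Qed.

(** The hypothesis makes [mu] squarefree with support inside [A]; its degree is then a sum over [A]
    of exponents at most 1. *)
Lemma multilinear_mdeg (A : {fset V}) (mu : {cmonom V}) :
  (forall x, mu x <= (x \in A))%N -> (mdeg mu <= #|` A|)%N.
Proof.
move=> muA; rewrite (@mdegEw _ _ A).
  by rewrite -sum1_size; apply: leq_sum => x _; apply: leq_trans (muA x) (leq_b1 _).
apply/fsubsetP => x; rewrite -cmE_neq0 -lt0n => /leq_trans/(_ (muA x)).
by rewrite lt0b.
Qed.

(** A squarefree monomial is determined by its support, so the monomials of [p] inject into the
    power set of [A]. This avoids expanding [p]. *)
Lemma multilinear_card (A : {fset V}) p :
  (forall x, mbound (fun mu => mu x) (x \in A) p) ->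
  (#|` msupp p| <= 2 ^ #|` A|)%N.
Proof.
move=> pA; rewrite -card_fpowerset.
have supp_inj : {in msupp p &, injective (fun mu : {cmonom V} => finsupp mu)}.
  move=> m1 m2 m1p m2p /fsetP eq12; apply/eqP/cmP => x.
  have val01 (m : {cmonom V}) : m \in msupp p -> m x = (x \in finsupp m).
    move=> /(pA x) /= mx; have {}mx := leq_trans mx (leq_b1 _).
    rewrite -cmE_neq0; have [->|] := eqVneq (m x) 0%N => [//|].
    by rewrite -lt0n => m0; apply/eqP; rewrite eqn_leq mx.
  by rewrite !val01 // eq12.
rewrite -(size_map (fun mu : {cmonom V} => finsupp mu)).
apply: uniq_leq_size; first by rewrite map_inj_in_uniq ?fset_uniq.
move=> _ /mapP[mu mup ->]; rewrite fpowersetE; apply/fsubsetP => x.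
by rewrite -cmE_neq0 -lt0n => /leq_trans/(_ (pA x mu mup)); rewrite lt0b.
Qed.

End Bounds.

(** * Size and variables of a quadratized system *)

Section QuadrBounds.
Variables (K : comNzRingType) (V : choiceType).
Local Notation poly := {malg K[{cmonom V}]}.
Implicit Types (f : poly) (S : seq poly) (y : qvar K V).

Definition new_count f : nat := \sum_(mu <- msupp f) (mdeg mu - 2).

Definition new_vars f : seq (qvar K V) :=
  [seq New f mu k | mu <- msupp f, k <- iota 1 (mdeg mu - 2)].

Lemma size_new_vars f : size (new_vars f) = new_count f.
Proof.
rewrite size_allpairs_dep sumnE big_map; apply: eq_bigr => mu _.
by rewrite size_iota.
Qed.

Lemma size_quadr1 f : size (quadr1 f) = (new_count f).+1.
Proof.
rewrite size_rcons size_flatten /shape -map_comp sumnE big_map; congr _.+1.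
by apply: eq_bigr => mu _; rewrite /= size_map size_iota.
Qed.

Lemma size_quadr S : size (quadr S) = (\sum_(f <- S) (new_count f).+1)%N.
Proof.
rewrite size_flatten /shape -map_comp sumnE big_map.
by apply: eq_bigr => f _; exact: size_quadr1.
Qed.

(** A monomial of degree at most [d + 2] needs at most [d] new variables. *)
Lemma new_count_le f c d :
  (#|` msupp f| <= c)%N -> mbound mdeg d.+2 f -> (new_count f <= c * d)%N.
Proof.
move=> fc fd; apply: leq_trans (leq_mul fc (leqnn d)).
have -> : (#|` msupp f| * d = \sum_(mu <- msupp f) d)%N.
  by rewrite big_const_seq count_predT iter_addn_0 mulnC.
rewrite /new_count !big_seq.
by apply: leq_sum => mu /fd; rewrite leq_subLR.
Qed.

Section NewVariables.
Variable y : qvar K V.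
Hypothesis y_new : forall x, y <> Old K x.
(** Non-occurrence of [y] is phrased as a zero bound on its exponent, so that the closure rules of
    [mbound] apply. *)
Local Notation absent := (@mbound K _ (fun mu : {cmonom (qvar K V)} => mu y) 0).

Lemma absent_var (z : qvar K V) : y != z -> absent (var K z).
Proof. by move=> yz; have := @mbound_var_exp K _ z y; rewrite (negPf yz). Qed.

Lemma absent_old x : absent (var K (Old K x)).
Proof. by apply: absent_var; apply/eqP. Qed.

Lemma absent1 : absent 1.
Proof. by apply: mbound1; rewrite cm1. Qed.

Lemma absentM (p q : {malg K[{cmonom (qvar K V)}]}) :
  absent p -> absent q -> absent (p * q).
Proof. by move=> py qy; apply: (@mboundM _ _ _ _ 0 0) => // mu nu; rewrite cmM. Qed.

Lemma absent_qfactor mu k : absent (qfactor K mu k).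
Proof.
rewrite /qfactor; set s := map _ _; have [lt_k|ge_k] := ltnP k (size s).
  by have /mapP[x _ ->] := mem_nth 1 lt_k; exact: absent_old.
(* Beyond the last factor, [qfactor] takes its default value 1, which contains no variable. *)
by rewrite nth_default //; exact: absent1.
Qed.

(** The start of the chain is an original variable; the later links have exactly the indices
    [1, ..., mdeg mu - 2] listed in [new_vars f]. *)
Lemma absent_qchain f mu k :
  y \notin new_vars f -> mu \in msupp f -> (k <= mdeg mu - 2)%N ->
  absent (qchain f mu k).
Proof.
case: k => [|k] yf muf kd; first exact: absent_qfactor.
apply: absent_var; apply: contraNneq yf => ->.
by apply: allpairs_f_dep => //; rewrite mem_iota /= add1n ltnS.
Qed.

Lemma absent_qmonom f mu :
  y \notin new_vars f -> mu \in msupp f -> absent (qmonom f mu).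
Proof.
move=> yf muf; rewrite /qmonom; case: ifP => _.
  by apply: absentM; [exact: absent_qchain | exact: absent_qfactor].
apply: big_ind => [||x _]; [exact: absent1 | exact: absentM | exact: absent_old].
Qed.

Lemma absent_quadr1 f g : y \notin new_vars f -> g \in quadr1 f -> absent g.
Proof.
move=> yf; rewrite mem_rcons inE => /orP[/eqP->|].
  rewrite big_seq; apply: mbound_sum => mu muf.
  by apply: mboundZ; exact: absent_qmonom.
case/flatten_mapP => mu muf /mapP[k]; rewrite mem_iota => /andP[k0 kd] ->.
rewrite add1n ltnS in kd.
apply: mboundB; first exact: absent_qchain.
apply: absentM; last exact: absent_qfactor.
by apply: absent_qchain => //; apply: leq_trans kd; exact: leq_pred.
Qed.

Lemma absent_quadr S g :
  y \notin flatten [seq new_vars f | f <- S] -> g \in quadr S -> absent g.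
Proof.
move=> yS /flatten_mapP[f fS]; apply: absent_quadr1.
by apply: contra yS => yf; apply/flatten_mapP; exists f.
Qed.

End NewVariables.

Lemma notin_sys_vars S (x : V) :
  (forall f, f \in S -> mbound (fun mu : {cmonom V} => mu x) 0 f) ->
  x \notin sys_vars S.
Proof.
move=> Sx; rewrite mem_undup; apply/flatten_mapP => -[f fS].
case/flatten_mapP => mu /(Sx f fS); rewrite leqn0 => /eqP mu0.
case/flatten_mapP => z _; rewrite mem_nseq => /andP[+ /eqP xz].
by rewrite -xz mu0.
Qed.

End QuadrBounds.

(** * Counting equations and variables of the evaluated system *)

Section AlphaBounds.
Variables n m : nat.
Local Notation l := (bitlen n).
Local Notation hwce_eqs :=
  [seq hwce_eq m i j | i <- enum 'I_n, j <- enum 'I_l].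

Lemma card_msupp_acc i (j : 'I_l) : (#|` msupp (acc m i j)| <= 1)%N.
Proof.
by rewrite /acc; case: unlift => [i'|]; rewrite ?card_msupp_var ?msupp0 ?cardfs0.
Qed.

Lemma mdeg_acc i (j : 'I_l) : mbound mdeg 1 (acc m i j).
Proof.
by rewrite /acc; case: unlift => [i'|]; [exact: mbound_var_deg | exact: mbound0].
Qed.

(** For positive [n] the last accumulator is not the zero vector [a^(0)], so its bits are genuine
    unknowns sharing one index [i0]. *)
Lemma acc_max (n_gt0 : (0 < n)%N) :
  {i0 : 'I_n | forall j : 'I_l, acc m ord_max j = var (coef n m) (Avar i0 j)}.
Proof.
have : ord0 != ord_max :> 'I_n.+1 by rewrite -val_eqE /= neq_ltn n_gt0.
by case/unlift_some => i0 _ eq_i0; exists i0 => j; rewrite /acc eq_i0.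
Qed.

(** Every accumulator bit is a variable or zero, so each of the three summands, product included,
    has at most one monomial. *)
Lemma new_count_hwce_eq (i : 'I_n) (j : 'I_l) :
  (new_count (hwce_eq m i j) <= 3 * l)%N.
Proof.
apply: new_count_le.
  apply: leq_trans (card_msuppB _ _) (leq_add (card_msupp_acc _ _) _).
  apply: leq_trans (card_msuppD _ _) (leq_add (card_msupp_acc _ _) _).
  apply: leq_trans (card_msuppM _ _) _; rewrite card_msupp_var muln1.
  by apply: card_msupp_prod1 => h _; exact: card_msupp_acc.
apply: mboundB; first exact: mbound_leq _ (@mdeg_acc _ _).
apply: mboundD; first exact: mbound_leq _ (@mdeg_acc _ _).
(* At most [l] accumulator bits and one factor [v_i] give degree at most [l + 1], within the allowed
   [l + 2]. *)
apply: (@mbound_leq _ _ _ (\sum_(h < l | (h < j)%N) 1 + 1)%N).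
  rewrite addn1 ltnS; apply: leq_trans (leqnSn _).
  by rewrite sum1_card; apply: leq_trans (max_card _) _; rewrite card_ord.
apply: mboundM (@mbound_var_deg _ _ _); first exact: mdegM.
apply: mbound_prod => [||h _]; [exact: mdeg1 | exact: mdegM | exact: mdeg_acc].
Qed.

(** The [t_j] are coefficients, and within each summand distinct factors carry distinct unknowns, so
    no unknown gets an exponent above 1. *)
Lemma new_count_F_l : (0 < n)%N -> (new_count (F_l n m) <= 2 ^ l * l)%N.
Proof.
move=> /acc_max[i0 acc_i0].
pose A := [fset (Avar i0 j : unknown n) | j in 'I_l]%fset.
have cardA : (#|` A| <= l)%N.
  by apply: leq_trans (leq_imfset_card _ _ _) _; rewrite -cardE card_ord.
have F_A x : mbound (fun mu => mu x) (x \in A) (F_l n m).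
  have e1 : (mone : {cmonom (unknown n)}) x = 0%N by exact: cm1.
  have eM mu nu : (mmul mu nu : {cmonom (unknown n)}) x = (mu x + nu x)%N.
    exact: cmM.
  rewrite /F_l; apply: mbound_sum => j _.
  (* The exponent of [x] is bounded factor by factor: the leading factor, the factors with [h > j],
     and 0 for the constant [t_j + 1]. As [j] is not among those [h], the total is at most the
     number of indices [h] with [x = Avar i0 h]. *)
  apply: (@mbound_leq _ _ _
    (((x == Avar i0 j) + \sum_(h < l | (j < h)%N) (x == Avar i0 h)) + 0)%N).
    rewrite addn0; apply: (@leq_trans (\sum_(h < l) (x == Avar i0 h))%N).
      rewrite [leqRHS](bigD1 j) //= leq_add2l big_mkcond [leqRHS]big_mkcond /=.
      apply: leq_sum => h _; case: ltnP => // lt_jh.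
      by rewrite -val_eqE neq_ltn lt_jh orbT.
    (* By injectivity of [Avar i0], exactly one index matches when [x] lies in [A], and none
       otherwise. *)
    case: (boolP (x \in A)) => [/imfsetP[/= k _ ->]|xA].
      rewrite (bigD1 k) //= eqxx big1 // => h /negPf hk.
      by case: eqP => // -[/esym/eqP]; rewrite hk.
    rewrite big1 // => h _; case: eqP xA => // -> /negP[].
    by apply/imfsetP; exists h.
  apply: mboundM => //; last by apply: mboundD; [exact: mboundC | exact: mbound1].
  apply: mboundM => //.
    by apply: mboundD; [rewrite acc_i0; exact: mbound_var_exp | exact: mboundC].
  apply: mbound_prod => // h _; apply: mboundD; last exact: mbound1.
  by apply: mboundD; [rewrite acc_i0; exact: mbound_var_exp | exact: mboundC].
apply: new_count_le.
  by apply: leq_trans (multilinear_card F_A) _; rewrite leq_exp2l.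
move=> mu muF; do 2 apply: leqW; apply: leq_trans cardA.
by apply: multilinear_mdeg => x; exact: F_A.
Qed.

Lemma sum_hwce_eqs (c : {malg (coef n m)[{cmonom (unknown n)}]} -> nat) (d : nat) :
  (forall i j, c (hwce_eq m i j) <= d)%N ->
  (\sum_(f <- hwce_eqs) c f <= n * (l * d))%N.
Proof.
move=> cd; rewrite big_allpairs_dep /= big_enum /=.
rewrite -[n in (n * _)%N]card_ord -sum_nat_const; apply: leq_sum => i _.
rewrite big_enum /= -[l in (l * _)%N]card_ord -sum_nat_const.
exact: leq_sum.
Qed.

Lemma size_new_vars_hwce :
  (size (flatten [seq new_vars f | f <- hwce_eqs]) <= n * (l * (3 * l)))%N.
Proof.
rewrite size_flatten /shape -map_comp sumnE big_map.
rewrite (eq_bigr _ (fun f _ => size_new_vars f)).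
exact/sum_hwce_eqs/new_count_hwce_eq.
Qed.

Variable I : MLD n m.

(** Evaluating coefficients may kill monomials but creates none. *)
Lemma mbound_eval phi d f : mbound phi d f -> mbound phi d (eval_poly I f).
Proof.
move=> fd; rewrite /eval_poly big_seq; apply: mbound_sum => mu /fd mud nu.
by move/(fsubsetP msuppU_le); rewrite in_fset1 => /eqP->.
Qed.

Lemma num_eqs_alpha : (0 < n)%N ->
  (num_eqs (alpha_eval I) <= m + (n * (l * (3 * l).+1) + (2 ^ l * l).+1))%N.
Proof.
move=> n_gt0; rewrite /num_eqs size_map !size_cat size_map size_enum_ord.
rewrite leq_add2l size_quadr size_quadr1 addn0.
rewrite leq_add ?ltnS ?new_count_F_l //.
by apply: sum_hwce_eqs => i j; rewrite ltnS new_count_hwce_eq.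
Qed.

Lemma num_vars_alpha : (0 < n)%N ->
  (num_vars (alpha_eval I) <= n + n * l + (n * (l * (3 * l)) + 2 ^ l * l))%N.
Proof.
move=> n_gt0; pose old := @Old (coef n m) (unknown n).
pose olds := [seq old (Vvar i) | i <- enum 'I_n]
  ++ [seq old (Avar i j) | i <- enum 'I_n, j <- enum 'I_l].
pose news := flatten [seq new_vars f | f <- hwce_eqs] ++ new_vars (F_l n m).
apply: (@leq_trans (size (olds ++ news))); last first.
  rewrite !size_cat size_map size_allpairs !size_enum_ord size_new_vars.
  by rewrite leq_add2l leq_add ?size_new_vars_hwce ?new_count_F_l.
(* By contraposition: a variable outside both lists is shown to have exponent 0 in every
   equation. *)
apply: uniq_leq_size (undup_uniq _) _ => x; apply: contraTT.
rewrite !mem_cat !negb_or -!andbA => /and4P[xV xA xH xF].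
have x_new u : x <> old u.
  case: u => [i|i j] eq_x.
    by case/mapP: xV; exists i; rewrite ?mem_enum.
  by case/allpairsP: xA; exists (i, j); rewrite ?mem_enum.
apply: notin_sys_vars => g /mapP[f + ->]; rewrite !mem_cat => f_alpha.
apply: mbound_eval; case/or3P: f_alpha.
- case/mapP => i _ ->; apply: mboundD; last by apply: mboundC; rewrite cm1.
  by apply: mbound_sum => j _; apply: mboundZ; exact: absent_old.
- exact: (absent_quadr x_new xH).
- by rewrite orbF; exact: (absent_quadr1 x_new xF).
Qed.

End AlphaBounds.

(** * From bit lengths to real logarithms *)

Section Asymptotics.
Variable R : realType.
Implicit Types n : nat.

Lemma trunc_log_le_log2 n : (0 < n)%N -> (trunc_log 2 n)%:R <= log2 (n%:R : R).
Proof.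
move=> n_gt0; have ln2_gt0 : 0 < ln (2 : R) by rewrite ln_gt0 // ltr1n.
rewrite /log2 ler_pdivlMr // mulr_natl -lnXn // ler_ln ?posrE ?exprn_gt0 ?ltr0n //.
by rewrite -natrX ler_nat trunc_logP.
Qed.

(** For [n >= 2] the truncated logarithm is at least 1, so adding 1 at most doubles it. *)
Lemma bitlen_le_log2 n : (2 <= n)%N -> (bitlen n)%:R <= 2 * log2 (n%:R : R).
Proof.
move=> n_ge2; have n_gt0 := ltnW n_ge2.
apply: le_trans (ler_wpM2l _ (trunc_log_le_log2 n_gt0)) => //.
rewrite -natrM ler_nat mul2n -addnn /bitlen -addn1 leq_add2l.
by rewrite trunc_log_gt0.
Qed.

Lemma exp_bitlen_le n : (0 < n)%N -> (2 ^ bitlen n <= 2 * n)%N.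
Proof. by move=> n_gt0; rewrite expnS leq_mul2l trunc_logP. Qed.

(** The constant is [32 = 8 * 2 ^ 2], the square coming from [bitlen n <= 2 * log2 n]. *)
Lemma natr_le_nlog2 n k : (2 <= n)%N -> (k <= 8 * (n * bitlen n ^ 2))%N ->
  k%:R <= 32 * (n%:R * log2 (n%:R : R) ^+ 2).
Proof.
move=> n_ge2; rewrite -(ler_nat R) => /le_trans; apply.
rewrite natrM (natrM _ n) natrX (_ : 32 = 8 * 4 :> R); last by rewrite -natrM.
rewrite -mulrA ler_pM2l // [leRHS]mulrCA ler_pM2l ?ltr0n 1?ltnW //.
rewrite (_ : 4 = 2 ^+ 2 :> R); last by rewrite -natrX.
rewrite -exprMn ler_pXn2r ?nnegrE ?bitlen_le_log2 //.
exact: le_trans (bitlen_le_log2 n_ge2).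
Qed.

End Asymptotics.

Theorem theorem3p15 (R : realType) :
  exists (C : R) (N : nat), 0 < C /\
    forall n m : nat, (N <= n)%N -> (m <= n)%N ->
    forall I : MLD n m,
      (num_vars (alpha_eval I))%:R <= C * (n%:R * log2 (n%:R : R) ^+ 2) /\
      (num_eqs (alpha_eval I))%:R <= C * (n%:R * log2 (n%:R : R) ^+ 2).
Proof.
exists 32, 2%N; split=> // n m n_ge2 le_mn I.
have n_gt0 : (0 < n)%N by exact: ltnW.
have l_gt0 : (0 < bitlen n)%N by [].
have := exp_bitlen_le n_gt0.
have := num_eqs_alpha I n_gt0; have := num_vars_alpha I n_gt0.
(* With [l] and [e = 2 ^ l] abstracted, only [l >= 1], [e <= 2 * n] and [m <= n] matter. Bounding
   each term by a multiple of [n * l ^ 2] gives coefficients [1 + 1 + 3 + 2 = 7] for variables and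
   [1 + 3 + 1 + 2 + 1 = 8] for equations, whence the factor 8. *)
move: (bitlen n) (2 ^ bitlen n)%N l_gt0 (@natr_le_nlog2 R n) => l e l_gt0 natr_le.
move=> vars_le eqs_le e_le.
split; apply: natr_le => //.
  by apply: leq_trans vars_le _; nia.
by apply: leq_trans eqs_le _; nia.
Qed.
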